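(* Let $m,n\geq k\geq 1$ be integers. Given $A\in\mathbb{R}^{m\times n}$, the following statements are equivalent: (1) The matrix $A$ is totally negative of order $k$. (2) For every $r\in[1,k]$ and every contiguous $r\times r$ submatrix $A_r$ of $A$, defining the vectors $$x^{A_r}:=(A_r^{11},0,A_r^{13},0,\ldots)^T\in\mathbb{R}^r,\qquad q^{A_r}:=A_rx^{A_r},$$ the vectors $0$ and $-x^{A_r}$ are the only solutions of $\mathrm{LCP}(A_r,q^{A_r})$ (that is, the solution set is exactly $\{0,-x^{A_r}\}$).
   Context: A real matrix is totally negative of order $k$ if all its minors of order at most $k$ are negative. A contiguous submatrix is a submatrix whose rows and columns are indexed by sets of consecutive integers. $[a,b]$ is the set of integers from $a$ to $b$. For $M\in\mathbb{R}^{r\times r}$ and $i,j\in[1,r]$, $M^{ij}$ denotes the determinant of the $(r-1)\times(r-1)$ submatrix of $M$ obtained by deleting the $i$th row and the $j$th column; if $r=1$, by convention $M^{11}:=-1$. Thus the $j$th coordinate of $x^{A_r}$ is $A_r^{1j}$ for $j$ odd and $0$ for $j$ even. For $M\in\mathbb{R}^{r\times r}$ and $q\in\mathbb{R}^r$, the Linear Complementarity Problem $\mathrm{LCP}(M,q)$ asks for $x\in\mathbb{R}^r$ with $x\geq0$, $y=Mx+q\geq0$ (coordinatewise) and $x^Ty=0$; such an $x$ is called a solution. *)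

(* Defs.v *)
From mathcomp Require Import all_boot all_order all_algebra.
From mathcomp Require Import reals.

Set Implicit Arguments.
Unset Strict Implicit.
Unset Printing Implicit Defensive.

Import Order.TTheory GRing.Theory Num.Theory.
Local Open Scope ring_scope.

(* A submatrix of [A] is [mxsub f g A] with [f] and [g] strictly increasing;
   the orders of minors start at 1, since [\det] of a 0 x 0 matrix is 1. *)
Definition totally_negative (R : realType) (m n k : nat) (A : 'M[R]_(m, n)) : Prop :=
  forall (r : nat) (f : 'I_r -> 'I_m) (g : 'I_r -> 'I_n),
    (0 < r <= k)%N ->
    {homo f : i j / (i < j)%N} -> {homo g : i j / (i < j)%N} ->
    \det (mxsub f g A) < 0.

Definition consecutive (r m : nat) (f : 'I_r -> 'I_m) : Prop :=
  exists a : nat, forall i : 'I_r, nat_of_ord (f i) = (a + i)%N.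

Definition contiguous_submx (R : realType) (m n r : nat)
    (A : 'M[R]_(m, n)) (B : 'M[R]_r) : Prop :=
  exists (f : 'I_r -> 'I_m) (g : 'I_r -> 'I_n),
    [/\ consecutive f, consecutive g & B = mxsub f g A].

(* Unsigned, unlike [cofactor]; the value -1 at order 1 is a convention. *)
Definition del_minor (R : realType) (r : nat) (M : 'M[R]_r) (i j : 'I_r) : R :=
  if r == 1%N then -1 else \det (row' i (col' j M)).

(* Indices start at 0 here, so the odd positions of 1-based indexing are the
   even [j]. *)
Definition xvec (R : realType) (r : nat) (M : 'M[R]_r.+1) : 'cV[R]_r.+1 :=
  \col_j (if odd j then 0 else del_minor M ord0 j).

Definition qvec (R : realType) (r : nat) (M : 'M[R]_r.+1) : 'cV[R]_r.+1 :=
  M *m xvec M.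

Definition lcp_solution (R : realType) (r : nat) (M : 'M[R]_r) (q x : 'cV[R]_r) : Prop :=
  let y := M *m x + q in
  [/\ forall i, 0 <= x i 0, forall i, 0 <= y i 0 & x^T *m y = 0].

(* Main.v *)
Require Import Defs.
From mathcomp Require Import all_boot all_order all_algebra.
From mathcomp Require Import reals.
From mathcomp Require Import ring lra zify.

Set Implicit Arguments.
Unset Strict Implicit.
Unset Printing Implicit Defensive.

Import Order.TTheory GRing.Theory Num.Theory.
Local Open Scope ring_scope.

(** Write [x] for [xvec M] and [c] for the vector of signed cofactors of the
    first row of [M].  Then [c = x - x'], where [x'] carries the unsigned minors
    that [x] leaves out, and [M c = det M e_0].

    From the complementarity problems to negative minors, by induction on the
    order: once the minors of order [r >= 1] are negative, for [M] of order
    [r + 1] the vector [- x'] is nonnegative and nonzero, and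
    [M (- x') + M x = M c = det M e_0].  As the coordinate 0 of [- x'] vanishes,
    [- x'] would be a third solution if [det M] were nonnegative, so [det M < 0]
    ([lcp_det_lt0], which settles order 1 directly).  This only reaches
    contiguous submatrices; the other minors follow by an analogue of
    Fekete's criterion for negative minors ([fekete_negative]), where a
    submatrix with a gap in its rows is narrowed by a three-term Plucker
    relation ([plucker3]).

    From negative minors to the complementarity problems: let [z] be a solution
    and put [w = z + x].  Since [x <= 0], complementarity gives
    [w_i (M w)_i <= 0] for all [i], and [(M w)_i = 0] as soon as [w_i > 0].  For
    a matrix whose principal minors are all negative, this excludes [w_i > 0]
    ([N_matrix_sign_reversal]): otherwise, on the support of [w], the vector [w]
    would be in the kernel of [M + D] with [D] a nonnegative diagonal matrix with
    a zero on its diagonal, but such an [M + D] has a negative determinant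
    ([N_matrix_det_add_diag_lt0]).  Hence [w <= 0].  Either [w = 0], that is
    [z = - x], or [M w > 0] because the entries of [M] are negative, and then
    complementarity gives [z = 0]. *)

(** * Increasing index maps *)

Definition increasing r m (f : 'I_r -> 'I_m) := {homo f : i j / (i < j)%N}.

Lemma increasing_lift n (j : 'I_n) : increasing (lift j).
Proof. by move=> i1 i2 /= lt12; rewrite /bump; lia. Qed.

Lemma increasing_comp r s m (f : 'I_s -> 'I_m) (g : 'I_r -> 'I_s) :
  increasing f -> increasing g -> increasing (f \o g).
Proof. by move=> fI gI i j ltij; apply/fI/gI. Qed.

Lemma consecutive_increasing r m (f : 'I_r -> 'I_m) :
  consecutive f -> increasing f.
Proof. by case=> a fE i j; rewrite !fE ltn_add2l. Qed.

Lemma increasing_leq r m (f : 'I_r -> 'I_m) : increasing f -> (r <= m)%N.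
Proof.
move=> fI; suff /(leq_card f) : injective f by rewrite !card_ord.
move=> i j fE; apply: ord_inj.
by have [/fI|/fI|//] := ltngtP i j; rewrite fE ltnn.
Qed.

(** * Matrices with negative principal minors *)

Definition N_matrix (R : numDomainType) n (A : 'M[R]_n) :=
  forall r (f : 'I_r.+1 -> 'I_n), increasing f -> \det (mxsub f f A) < 0.

Lemma N_matrix_del (R : numDomainType) n (A : 'M[R]_n) (j : 'I_n) :
  N_matrix A -> N_matrix (row' j (col' j A)).
Proof.
move=> NA r f fI; have /(NA _) : increasing (lift j \o f).
  exact: increasing_comp (@increasing_lift _ j) fI.
by congr (\det _ < 0); apply/matrixP=> a b; rewrite !mxE.
Qed.

(** The determinant is affine in the [j]-th diagonal entry, and the slope is the
    complementary principal minor.  This drives an induction on the number of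
    nonzero entries of [d]. *)
Lemma det_add_diag_split (R : comPzRingType) n (A : 'M[R]_n) (d : 'rV[R]_n)
    (j : 'I_n) :
  \det (A + diag_mx d) =
  \det (A + diag_mx (\row_l (if l == j then 0 else d 0 l))) +
  d 0 j * \det (row' j (col' j A) + diag_mx (\row_l d 0 (lift j l))).
Proof.
set d0 := \row_l _; set d1 := \row_l _.
rewrite !(expand_det_row _ j).
have cofE l : cofactor (A + diag_mx d) j l = cofactor (A + diag_mx d0) j l.
  congr (_ * \det _); apply/matrixP=> a b; rewrite !mxE.
  by rewrite [lift j a == j]eq_sym (negPf (neq_lift _ _)).
have <- : cofactor (A + diag_mx d) j j =
    \det (row' j (col' j A) + diag_mx d1).
  rewrite /cofactor addnn -muln2 exprM sqrr_sign mul1r; congr (\det _).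
  by apply/matrixP=> a b; rewrite !mxE (inj_eq lift_inj).
rewrite (bigD1 j) //= [X in _ = X + _](bigD1 j) //=.
rewrite -cofE !mxE eqxx mulr1n mul0rn addr0 mulrDl addrAC; congr (_ + _ + _).
by apply: eq_bigr => l nlj; rewrite cofE !mxE eq_sym (negPf nlj) !mulr0n.
Qed.

(** Expand the determinant as a sum of principal minors of [A] times products of
    entries of [d].  The only term that could be positive is that of the empty
    minor, with coefficient [\prod_j d 0 j], and it vanishes because
    [d 0 i = 0]; the principal minor on the zeros of [d] gives a negative term.
    The induction obtains this by splitting off one nonzero entry of [d] at a
    time. *)
Lemma N_matrix_det_add_diag_lt0 (R : numDomainType) n (A : 'M[R]_n)
    (d : 'rV[R]_n) (i : 'I_n) :
  N_matrix A -> (forall j, 0 <= d 0 j) -> d 0 i = 0 ->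
  \det (A + diag_mx d) < 0.
Proof.
(* The size [n] varies too, as a split also yields a matrix of size [n.-1]. *)
have [c leDc] := ubnP (\sum_j (d 0 j != 0)%R)%N.
elim: c n A d i leDc => // c IHc n A d i ltDc NA d_ge0 di0.
have [/existsP[j dj] | /existsPn d0] := boolP [exists j, d 0 j != 0];
  last first.
  have -> : d = 0.
    by apply/rowP=> j; rewrite mxE; apply/eqP; rewrite -[_ == _]negbK d0.
  rewrite raddf0 addr0.
  case: n A i {d ltDc di0 d_ge0 d0} NA => [_ [] //|n] A i NA.
  rewrite -[A]mxsub_id; exact: (NA n id).
have nij : i != j by apply: contraNneq dj => <-; rewrite di0.
have [k iE] : exists k, i = lift j k.
  by case: (unliftP j i) nij => [k -> _ | ->]; [exists k | rewrite eqxx].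
move: ltDc; rewrite (bigD1_ord j) //= dj add1n ltnS => ltDc.
rewrite (det_add_diag_split _ _ j) -[ltRHS]addr0 ltrD //.
  apply: (IHc _ _ _ i) => //; last by rewrite mxE (negPf nij).
  - rewrite (bigD1_ord j) //= mxE eqxx eqxx add0n.
    rewrite (eq_bigr (fun l => d 0 (lift j l) != 0 : nat)) // => l _.
    by rewrite mxE [lift j l == j]eq_sym (negPf (neq_lift _ _)).
  - by move=> l; rewrite mxE; case: ifP.
have dj_gt0 : 0 < d 0 j by rewrite lt_def dj d_ge0.
rewrite pmulr_rlt0 {dj_gt0}//.
apply: (IHc _ _ _ k); first by under eq_bigr do rewrite mxE.
- exact: N_matrix_del.
- by move=> l; rewrite mxE.
- by rewrite mxE -iE.
Qed.

(** Deleting the indices where [w] vanishes keeps the hypotheses, so [w] may be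
    assumed nowhere zero.  Then [A w = - D w] for the diagonal matrix [D] of the
    ratios [- (A w)_j / w_j >= 0], and [D] has a zero at [i]: were [w i 0]
    nonzero, the invertible matrix [A + D] would kill a nonzero vector. *)
Lemma N_matrix_sign_reversal (R : realFieldType) n (A : 'M[R]_n) (w : 'cV[R]_n)
    (i : 'I_n) :
  N_matrix A -> (forall j, w j 0 * (A *m w) j 0 <= 0) -> (A *m w) i 0 = 0 ->
  w i 0 = 0.
Proof.
elim: n A w i => [? ? []//|n IHn] A w i NA rev yi0.
apply/eqP/negP => /negP wi.
have [/existsP[j /eqP wj] | /existsPn w_neq0] := boolP [exists j, w j 0 == 0].
  have nij : i != j by apply: contraNneq wi => ->; rewrite wj.
  have [k iE] : exists k, i = lift j k.
    by case: (unliftP j i) nij => [k -> _ | ->]; [exists k | rewrite eqxx].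
  have yE a : (row' j (col' j A) *m row' j w) a 0 = (A *m w) (lift j a) 0.
    rewrite !mxE [RHS](bigD1_ord j) //= wj mulr0 add0r.
    by apply: eq_bigr => b _; rewrite !mxE.
  case/eqP: wi; have := IHn _ (row' j w) k (N_matrix_del j NA).
  rewrite iE [row' j w k 0]mxE; apply; last by rewrite yE -iE.
  by move=> a; rewrite yE mxE.
pose d := \row_j (- (A *m w) j 0 / w j 0).
have d_ge0 j : 0 <= d 0 j.
  have -> : d 0 j = - (w j 0 * (A *m w) j 0) * (w j 0)^-1 ^+ 2.
    by rewrite mxE; have := w_neq0 j => ?; field.
  by rewrite mulr_ge0 ?sqr_ge0 // oppr_ge0.
have : \det (A + diag_mx d) < 0.
  apply: (N_matrix_det_add_diag_lt0 (i := i)); rewrite // mxE yi0.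
  by rewrite oppr0 mul0r.
move=> /ltr0_neq0; rewrite -unitfE -unitmxE => U.
have /(congr1 (mulmx (invmx (A + diag_mx d)))) : (A + diag_mx d) *m w = 0.
  apply/colP=> j; rewrite mulmxDl mxE mul_diag_mx !mxE.
  by rewrite mulfVK // subrr.
by rewrite mulKmx // mulmx0 => /colP/(_ i)/eqP; rewrite mxE; apply/negP.
Qed.

(** * A three-term Plucker relation *)

(** The generalized cross product of the rows of [W]: its scalar product with a
    row [u] is the determinant of [W] with [u] added on top. *)
Definition maximal_minors_kernel (R : comPzRingType) q (W : 'M[R]_(q, q.+1)) :
    'cV[R]_q.+1 :=
  \col_l ((-1) ^+ l * \det (col' l W)).

(** Keeping the sign of the inserted position [s] explicit lets the same kernel
    vector express several minors that differ from [rowsub h B] by one row,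
    without sorting permutations. *)
Lemma det_insert_row (R : comPzRingType) m q (B : 'M[R]_(m, q.+1))
    (h : 'I_q -> 'I_m) (f : 'I_q.+1 -> 'I_m) (s : 'I_q.+1) :
  (forall a, f (lift s a) = h a) ->
  \det (rowsub f B) =
  (-1) ^+ s * (B *m maximal_minors_kernel (rowsub h B)) (f s) 0.
Proof.
move=> fE; rewrite (expand_det_row _ s) mxE big_distrr /=.
apply: eq_bigr => l _; rewrite !mxE /cofactor exprD -mulrA mulrCA.
congr (_ * (_ * (_ * \det _))).
by apply/matrixP=> a b; rewrite !mxE fE.
Qed.

(** Inserting a row that is already present gives a determinant with two equal
    rows. *)
Lemma mul_maximal_minors_kernel (R : comPzRingType) m q (B : 'M[R]_(m, q.+1))
    (h : 'I_q -> 'I_m) (a : 'I_q) :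
  (B *m maximal_minors_kernel (rowsub h B)) (h a) 0 = 0.
Proof.
pose f := oapp h (h a) \o unlift ord0.
have fl b : f (lift ord0 b) = h b by rewrite /f /= liftK.
have f0 : f ord0 = h a by rewrite /f /= unlift_none.
have := det_insert_row B fl; rewrite f0 expr0 mul1r => <-.
apply: (determinant_alternate (neq_lift ord0 a)) => l.
by rewrite !mxE f0 fl.
Qed.

(** The left-hand side expands the determinant of [M] with a duplicate of its
    column [l] added on the left. *)
Lemma alternating_maximal_minors (R : comPzRingType) p (M : 'M[R]_(p.+1, p))
    (l : 'I_p) :
  \sum_(i < p.+1) (-1) ^+ i * \det (row' i M) * M i l = 0.
Proof.
pose X : 'M_p.+1 := row_mx (col l M) M.
have X0 i : X i ord0 = M i l.
  have -> : ord0 = lshift p ord0 :> 'I_(1 + p) by apply: val_inj.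
  by rewrite [LHS](row_mxEl (col l M) M) mxE.
have Xr i b : X i (lift ord0 b) = M i b.
  by rewrite -rshift1 [LHS](row_mxEr (col l M) M).
have detX : \det X = 0.
  rewrite -det_tr; apply: (determinant_alternate (neq_lift ord0 l)) => i.
  by rewrite mxE [RHS]mxE X0 Xr.
rewrite -[RHS]detX (expand_det_col _ ord0); apply: eq_bigr => i _.
rewrite X0 mulrC /cofactor addn0; congr (_ * (_ * \det _)).
by apply/matrixP=> a b; rewrite [LHS]mxE [RHS]mxE [RHS]mxE Xr.
Qed.

(** Among the rows of [M], the first, the last and the intermediate row
    [lift ord0 j] are distinguished, and the other [q] rows are shared by all
    the minors of [N].  The maximal minors of [M], with alternating signs, form a
    left kernel vector of [M], hence of [N].  Pairing it with [N g], where [g] is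
    the kernel vector of the shared rows of [N], kills every term except the
    three distinguished ones, whose [N g] entries are minors of [N] up to sign.
    The indices leave all submatrices with their rows in increasing order. *)
Lemma plucker3 (R : comPzRingType) q (M : 'M[R]_(q.+3, q.+2)) (s : 'I_q.+1) :
  let N := col' ord0 M in
  let j := lift ord_max s in
  \det (row' (lift ord0 j) M) * \det (rowsub (lift ord0 \o lift ord_max) N) =
  \det (row' ord0 M) * \det (rowsub (lift ord_max \o lift (lift ord0 s)) N) +
  \det (row' ord_max M) * \det (rowsub (lift ord0 \o lift j) N).
Proof.
move=> N j.
pose h : 'I_q -> 'I_q.+3 := lift ord0 \o (lift j \o lift ord_max).
pose g := maximal_minors_kernel (rowsub h N).
have sle : (s <= q)%N by rewrite -ltnS.
have sum0 : \sum_(i < q.+3) (-1) ^+ i * \det (row' i M) * (N *m g) i 0 = 0.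
  under eq_bigr do rewrite mxE big_distrr.
  rewrite exchange_big /= big1 // => l _.
  under eq_bigr do rewrite mulrA [N _ _]mxE.
  by rewrite -big_distrl /= alternating_maximal_minors mul0r.
have lastE : lift ord0 (lift j ord_max) = ord_max.
  by apply: val_inj; rewrite /= /bump /=; lia.
have det0max : \det (rowsub (lift ord0 \o lift ord_max) N) =
    (-1) ^+ s * (N *m g) (lift ord0 j) 0.
  apply: det_insert_row => a; congr (lift _ _); apply: val_inj.
  by rewrite /= /bump /=; have := ltn_ord a; lia.
have det0j : \det (rowsub (lift ord0 \o lift j) N) =
    (-1) ^+ q * (N *m g) ord_max 0.
  rewrite -lastE; exact: (det_insert_row _ (s := ord_max)).
have detjmax : \det (rowsub (lift ord_max \o lift (lift ord0 s)) N) =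
    (N *m g) ord0 0.
  rewrite (det_insert_row _ (s := ord0) (h := h)) => [|a].
    by rewrite expr0 mul1r; congr ((_ *m _) _ _); apply: val_inj.
  by apply: val_inj; rewrite /= /bump /=; have := ltn_ord a; lia.
move: sum0; rewrite big_ord_recl /= (bigD1_ord j) //= big_ord_recr /= big1.
  rewrite lastE det0max det0j detjmax expr0 mul1r add0r.
  rewrite (_ : bump q.+1 s = s); last by rewrite /bump; lia.
  rewrite (_ : bump s q = q.+1); last by rewrite /bump; lia.
  rewrite /bump /= !add1n !exprS !mulN1r opprK !mulNr addrCA addrC.
  move/eqP; rewrite subr_eq0 => /eqP sum0.
  by rewrite mulrCA mulrA -sum0 -mulrA mulrCA.
move=> a _; have -> : widen_ord (leqnSn q) a = lift ord_max a.
  by apply: val_inj; rewrite [RHS]lift_max.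
by rewrite mul_maximal_minors_kernel mulr0.
Qed.

(** * Fekete's criterion for negative minors *)

(** The map [h] inserts into [f] the integer that follows [f s], where [s] is the
    last index before a gap.  Its position is neither the first nor the last, so
    [h] has the same end points as [f]. *)
Lemma consecutive_or_gap p m (f : 'I_p.+1 -> 'I_m) : increasing f ->
  consecutive f \/
  exists (s : 'I_p) (h : 'I_p.+2 -> 'I_m),
    increasing h /\ f =1 h \o lift (lift ord0 (lift ord_max s)).
Proof.
move=> fI.
have [/existsP[s gap] | /existsPn nogap] :=
  boolP [exists s : 'I_p, (f (lift ord_max s)).+1 < f (lift ord0 s)]%N.
  right; set j := lift ord0 (lift ord_max s).
  have tm : ((f (lift ord_max s)).+1 < m)%N by exact: ltn_trans gap (ltn_ord _).
  pose t := Ordinal tm.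
  have fmono (i i' : 'I_p.+1) : (i <= i')%N -> (f i <= f i')%N.
    by rewrite leq_eqVlt => /predU1P[/val_inj -> // | /fI /ltnW].
  have jE : val j = s.+1 by rewrite /= /bump /=; have := ltn_ord s; lia.
  exists s, (oapp f t \o unlift j); split=> [a b | a /=]; last by rewrite liftK.
  case: (unliftP j a) => [a' | ] ->; case: (unliftP j b) => [b' | ] -> /=;
    rewrite ?liftK ?unlift_none /=; last by rewrite ltnn.
  - by move=> lt; apply: fI; move: lt; rewrite /bump; lia.
  - rewrite [bump 0 _]jE => lt; rewrite ltnS; apply: fmono.
    by move: lt; rewrite lift_max /bump /=; lia.
  - rewrite [bump 0 _]jE => lt; apply: leq_trans gap _; apply: fmono.
    by move: lt; rewrite /= /bump; lia.
left; exists (f ord0) => i; case: i => i; elim: i => [|i IHi] lti.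
  by rewrite addn0; congr (val (f _)); apply: val_inj.
have ip : (i < p)%N by [].
have fi : f (lift ord_max (Ordinal ip)) = (f ord0 + i)%N :> nat.
  rewrite -(IHi (ltnW lti)); congr (val (f _)); apply: val_inj.
  by rewrite [LHS]lift_max.
have -> : Ordinal lti = lift ord0 (Ordinal ip) by apply: val_inj.
apply/eqP; rewrite eqn_leq addnS -fi leqNgt nogap /=.
by apply: fI; rewrite lift_max.
Qed.

(** Induction on the spread [f ord_max - f ord0].  If the rows have a gap, add a
    row inside it.  In [plucker3] for the resulting rows, the minor of [f] is
    multiplied by a negative minor of order [q.+1], and the two other maximal
    minors omit an end row, so their spread is smaller and they are negative:
    both products on the right are positive, which makes the minor of [f]
    negative. *)
Lemma fekete_rows (R : realDomainType) m q (B : 'M[R]_(m, q.+2)) :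
  (forall f : 'I_q.+1 -> 'I_m, increasing f ->
     \det (rowsub f (col' ord0 B)) < 0) ->
  (forall f : 'I_q.+2 -> 'I_m, consecutive f -> \det (rowsub f B) < 0) ->
  forall f : 'I_q.+2 -> 'I_m, increasing f -> \det (rowsub f B) < 0.
Proof.
move=> neg_small neg_contig f.
have [c] := ubnP (f ord_max - f ord0)%N.
elim: c f => // c IHc f ltc fI.
have [/neg_contig // | [s [h [hI fE]]]] := consecutive_or_gap fI.
have neg_h (g : 'I_q.+1 -> 'I_q.+3) : increasing g ->
    \det (rowsub g (col' ord0 (rowsub h B))) < 0.
  move=> gI; have := neg_small _ (increasing_comp hI gI).
  by congr (\det _ < 0); apply/matrixP=> a b; rewrite !mxE.
have neg_end (e : 'I_q.+3) : (h (lift e ord_max) - h (lift e ord0) < c)%N ->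
    \det (row' e (rowsub h B)) < 0.
  move=> lte; have := IHc _ lte (increasing_comp hI (@increasing_lift _ e)).
  by congr (\det _ < 0); apply/matrixP=> a b; rewrite !mxE.
have f0 : f ord0 = h ord0 by rewrite fE; congr h; apply: val_inj.
have fmax : f ord_max = h ord_max.
  rewrite fE; congr h; apply: val_inj; rewrite /= /bump /=.
  by have := ltn_ord s; lia.
have h0 : (h ord0 < h (lift ord0 ord0))%N by apply: hI.
have hmax : (h (lift ord_max ord_max) < h ord_max)%N.
  by apply: hI; rewrite lift_max.
have h0max : (h (lift ord0 ord0) <= h (lift ord_max ord_max))%N.
  case: (posnP q) => [q0 | q_gt0].
    by apply: eq_leq; congr (val (h _)); apply: val_inj; rewrite /= /bump q0.
  by apply/ltnW/hI; rewrite /= /bump /=; lia.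
have /= := plucker3 (rowsub h B) s.
rewrite f0 fmax in ltc.
have neg_lift2 (a : 'I_q.+3) (b : 'I_q.+2) := neg_h (lift a \o lift b)
  (increasing_comp (@increasing_lift _ a) (@increasing_lift _ b)).
have P0 : \det (row' ord0 (rowsub h B)) < 0.
  apply: neg_end; have -> : lift ord0 ord_max = ord_max :> 'I_q.+3.
    by apply: val_inj.
  by lia.
have Pmax : \det (row' ord_max (rowsub h B)) < 0.
  apply: neg_end; have -> : lift ord_max ord0 = ord0 :> 'I_q.+3.
    by apply: val_inj.
  by lia.
have -> : row' (lift ord0 (lift ord_max s)) (rowsub h B) = rowsub f B.
  by apply/matrixP=> a b; rewrite !mxE fE.
move=> pl; rewrite -(nmulr_lgt0 _ (neg_lift2 ord0 ord_max)) pl.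
by rewrite addr_gt0 // nmulr_lgt0.
Qed.

(** Two applications of [fekete_rows], first to the rows with consecutive columns
    held fixed, then by transposition to the columns with arbitrary rows. *)
Lemma fekete_negative (R : realDomainType) m n p (A : 'M[R]_(m, n)) :
  (forall (f : 'I_p -> 'I_m) (g : 'I_p -> 'I_n), (0 < p)%N ->
     increasing f -> increasing g -> \det (mxsub f g A) < 0) ->
  (forall (f : 'I_p.+1 -> 'I_m) (g : 'I_p.+1 -> 'I_n),
     consecutive f -> consecutive g -> \det (mxsub f g A) < 0) ->
  forall (f : 'I_p.+1 -> 'I_m) (g : 'I_p.+1 -> 'I_n),
    increasing f -> increasing g -> \det (mxsub f g A) < 0.
Proof.
case: p => [_ neg_contig f g _ _|q neg_small neg_contig f g fI gI].
  by apply: neg_contig; [exists (f ord0) | exists (g ord0)] => i;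
     rewrite (ord1 i) addn0.
rewrite -det_tr; have -> : (mxsub f g A)^T = rowsub g (rowsub f A)^T.
  by apply/matrixP=> a b; rewrite !mxE.
apply: fekete_rows gI => [{}g gI | {}g gC].
  rewrite -det_tr; have := neg_small _ _ isT
    (increasing_comp fI (@increasing_lift _ ord0)) gI.
  by congr (\det _ < 0); apply/matrixP=> a b; rewrite !mxE.
rewrite -det_tr; have -> : (rowsub g (rowsub f A)^T)^T = rowsub f (colsub g A).
  by apply/matrixP=> a b; rewrite !mxE.
apply: fekete_rows fI => [{}f fI | {}f fC].
  have := neg_small _ _ isT fI
    (increasing_comp (consecutive_increasing gC) (@increasing_lift _ ord0)).
  by congr (\det _ < 0); apply/matrixP=> a b; rewrite !mxE.
have := neg_contig _ _ fC gC.
by congr (\det _ < 0); apply/matrixP=> a b; rewrite !mxE.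
Qed.

(** * Linear complementarity problems *)

(** Since [qvec M = M *m xvec M], the slack of [z] is [M *m w] for
    [w = z + xvec M].  As [xvec M <= 0], complementarity makes [w] a vector whose
    signs [M] reverses, and a positive entry of [w] comes from a positive entry
    of [z], where the slack vanishes; so no entry of [w] is positive. *)
Lemma lcp_unique (R : realType) r (M : 'M[R]_r.+1) (z : 'cV[R]_r.+1) :
  N_matrix M -> (forall i j, M i j < 0) -> (forall j, xvec M j 0 <= 0) ->
  lcp_solution M (qvec M) z -> z = 0 \/ z = - xvec M.
Proof.
move=> NM M_lt0 x_le0 [z_ge0 y_ge0 zy0].
rewrite /qvec -mulmxDr in y_ge0 zy0.
set w := z + xvec M in y_ge0 zy0.
have compl i : z i 0 * (M *m w) i 0 = 0.
  have := zy0 => /matrixP/(_ 0 0); rewrite mxE [RHS]mxE => sum0.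
  have := @psumr_eq0P _ _ xpredT (fun i => z^T 0 i * (M *m w) i 0).
  move=> /(_ _ sum0 i isT); rewrite mxE; apply => j _.
  by rewrite mxE mulr_ge0.
have w_le0 i : w i 0 <= 0.
  rewrite leNgt; apply/negP => wi_gt0.
  have zi_gt0 : 0 < z i 0.
    apply: lt_le_trans wi_gt0 _; rewrite mxE -[leRHS]addr0 lerD //.
  have yi0 : (M *m w) i 0 = 0.
    by move/eqP: (compl i); rewrite mulf_eq0 gt_eqF // => /eqP.
  suff wi0 : w i 0 = 0 by rewrite wi0 ltxx in wi_gt0.
  apply: N_matrix_sign_reversal NM _ yi0 => j.
  by rewrite [w j 0]mxE mulrDl compl add0r mulr_le0_ge0.
have [w0 | w_neq0] := eqVneq w 0.
  by right; apply/eqP; rewrite -addr_eq0; apply/eqP.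
left; have [l wl] : exists l, w l 0 != 0.
  apply/existsP; apply: contraNT w_neq0 => /existsPn w0.
  by apply/eqP/colP=> l; rewrite [RHS]mxE; apply/eqP; rewrite -[_ == _]negbK.
apply/colP=> i; rewrite [RHS]mxE; have /eqP := compl i.
rewrite mulf_eq0 => /orP[/eqP // | /eqP yi0].
suff : 0 < (M *m w) i 0 by rewrite yi0 ltxx.
rewrite mxE (bigD1 l) //= ltr_pwDl //.
  by rewrite nmulr_rgt0 // lt_def eq_sym wl w_le0.
by apply: sumr_ge0 => a _; rewrite mulr_le0 // ltW.
Qed.

Lemma totally_negative_lcp (R : realType) m n k (A : 'M[R]_(m, n)) r
    (M : 'M[R]_r.+1) (z : 'cV[R]_r.+1) :
  totally_negative k A -> (r.+1 <= k)%N -> contiguous_submx A M ->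
  lcp_solution M (qvec M) z <-> z = 0 \/ z = - xvec M.
Proof.
move=> tnA rk.
case=> f [g [/consecutive_increasing fI /consecutive_increasing gI ME]].
have minor_lt0 s (f' g' : 'I_s -> 'I_r.+1) : (0 < s)%N -> increasing f' ->
    increasing g' -> \det (mxsub f' g' M) < 0.
  move=> s_gt0 f'I g'I; rewrite ME -mxsub_comp.
  apply: tnA; [|exact: increasing_comp..].
  by rewrite s_gt0 (leq_trans (increasing_leq f'I)).
have M_lt0 i j : M i j < 0.
  have const1 (l : 'I_r.+1) : increasing (fun _ : 'I_1 => l).
    by move=> a b; rewrite !ord1 ltnn.
  by have := minor_lt0 1%N _ _ isT (const1 i) (const1 j); rewrite det_mx11 mxE.
have del_lt0 j : del_minor M ord0 j < 0.
  rewrite /del_minor; case: eqP => [_ | /eqP r_neq0]; first exact: ltrN10.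
  have := minor_lt0 r (lift ord0) (lift j); rewrite lt0n.
  move/(_ r_neq0 (@increasing_lift r.+1 _) (@increasing_lift r.+1 _)).
  by congr (\det _ < 0); apply/matrixP=> a b; rewrite !mxE.
have x_le0 j : xvec M j 0 <= 0 by rewrite mxE; case: ifP => // _; exact: ltW.
split=> [|[|] ->].
- apply: lcp_unique => // s f' f'I; exact: minor_lt0.
- split=> [i|i|]; rewrite ?mulmx0 ?add0r ?mxE // ?trmx0 ?mul0mx //.
  by rewrite sumr_ge0 // => j _; rewrite mulr_le0 // ltW.
- split=> [i|i|]; rewrite ?mulmxN ?addNr ?mulmx0 // mxE // oppr_ge0 //.
Qed.

(** If [\det M >= 0], the opposites of the minors at the odd indices, which
    [xvec M] replaces by zeros, form a third solution.  At order 1 there are no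
    odd indices: there the solution 0 forces [M 0 0 <= 0], and a zero matrix
    would make every nonnegative [z] a solution. *)
Lemma lcp_det_lt0 (R : realType) r (M : 'M[R]_r.+1) :
  (forall j, (0 < r)%N -> del_minor M ord0 j < 0) ->
  (forall z, lcp_solution M (qvec M) z <-> z = 0 \/ z = - xvec M) ->
  \det M < 0.
Proof.
case: r M => [|r] M del_lt0 sol.
  rewrite det_mx11.
  have xE : xvec M = (-1)%:M.
    by apply/colP=> i; rewrite !mxE ord1 /del_minor /= mulr1n.
  have qE : qvec M 0 0 = - M 0 0.
    by rewrite /qvec mxE big_ord1 xE mxE mulr1n mulrN1.
  rewrite lt_def eq_sym; apply/andP; split; last first.
    have [_ /(_ 0) + _] := (sol 0).2 (or_introl erefl).
    by rewrite mulmx0 add0r qE oppr_ge0.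
  (* The vector 2 differs from both 0 and [- xvec M = 1]. *)
  apply/eqP => M0; have : lcp_solution M (qvec M) 2%:M.
    have y0 : M *m 2%:M + qvec M = 0.
      by apply/colP=> i; rewrite ord1 mxE qE !mxE big_ord1 M0 mul0r subr0.
    rewrite /lcp_solution y0 mulmx0; split=> // i; rewrite !mxE //.
    by rewrite ord1 mulr1n.
  case/sol => /colP/(_ 0); rewrite ?xE !mxE !mulr1n; lra.
rewrite ltNge; apply/negP => det_ge0.
pose x' := \col_j (if odd j then del_minor M ord0 j else 0).
have cofE j : (xvec M - x') j 0 = cofactor M ord0 j.
  rewrite !mxE /cofactor /del_minor /= add0n -signr_odd.
  by case: (odd j); rewrite ?subr0 ?sub0r ?expr0 ?expr1 ?mul1r ?mulN1r.
have yE : M *m (- x') + qvec M = \det M *: delta_mx ord0 0.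
  rewrite /qvec -mulmxDr addrC; apply/colP=> i; have := mul_mx_adj M.
  move/matrixP/(_ i ord0); rewrite mxE [RHS]mxE => adjE.
  rewrite mxE [RHS]mxE mxE eqxx andbT mulr_natr -adjE.
  by apply: eq_bigr => j _; rewrite cofE mxE.
have : lcp_solution M (qvec M) (- x').
  rewrite /lcp_solution yE; split=> [i|i|].
  - by rewrite !mxE oppr_ge0; case: ifP => // _; exact/ltW/del_lt0.
  - by rewrite !mxE mulr_ge0.
  - apply/matrixP=> a b; rewrite mxE big1 ?mxE // => j _; rewrite !mxE.
    by case: (j =P ord0) => [-> | _]; rewrite /= ?oppr0 ?mul0r ?mulr0.
(* Index 1 separates [- x'] from 0 and from [- xvec M]. *)
have := del_lt0 (lift ord0 ord0) isT.
by move=> lt0; case/sol => /colP/(_ (lift ord0 ord0)); rewrite !mxE /= => E;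
  move: lt0; rewrite -[X in X < _]opprK E !oppr0 ltxx.
Qed.

Theorem theorem5 (R : realType) (m n k : nat)
    (hk : (1 <= k)%N) (hm : (k <= m)%N) (hn : (k <= n)%N) (A : 'M[R]_(m, n)) :
  totally_negative k A <->
  (forall (r : nat) (Ar : 'M[R]_r.+1),
     (1 <= r.+1 <= k)%N -> contiguous_submx A Ar ->
     forall x : 'cV[R]_r.+1,
       lcp_solution Ar (qvec Ar) x <-> (x = 0 \/ x = - xvec Ar)).
Proof.
split=> [tnA r Ar rk cAr x | lcpA].
  exact: totally_negative_lcp tnA rk cAr.
elim=> [//|r IHr] f g rk fI gI.
have {}IHr (f' : 'I_r -> 'I_m) (g' : 'I_r -> 'I_n) : (0 < r)%N ->
    increasing f' -> increasing g' -> \det (mxsub f' g' A) < 0.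
  by move=> r_gt0; apply: IHr; rewrite r_gt0 ltnW.
apply: (fekete_negative IHr _ fI gI) => {fI gI} {}f {}g fC gC.
apply: lcp_det_lt0 => [j r_gt0 | z].
  rewrite /del_minor eqSS gtn_eqF //.
  have := IHr _ _ r_gt0
    (increasing_comp (consecutive_increasing fC) (@increasing_lift _ ord0))
    (increasing_comp (consecutive_increasing gC) (@increasing_lift _ j)).
  by congr (\det _ < 0); apply/matrixP=> a b; rewrite !mxE.
by apply: lcpA => //; exists f, g.
Qed.
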